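(* Let $\Lambda=(\lambda_n)_{n\ge 1}$ be a non-decreasing sequence of positive reals tending to infinity with $\lambda_1=1$ and $\lambda_{n+1}\le\lambda_n+1$. For any Orlicz function $M$, $[V,\lambda,M,\widehat F]^G\subset S_\lambda^G(\widehat F)$.
   Context: An Orlicz function is a continuous, convex, non-decreasing function $M:[0,\infty)\to[0,\infty)$ with $M(0)=0$ and $M(x)>0$ for $x>0$. $I_n$ is the set of integers $k$ with $n-\lambda_n+1\le k\le n$. The Fibonacci numbers are $f_0=f_1=1$, $f_n=f_{n-1}+f_{n-2}$ for $n\ge2$. Geometric arithmetic: $\mathbb C(G)=\{e^z:z\in\mathbb C\}$, where elements are handled through their exponents ($e^z$ and $e^w$ are the same element iff $z=w$), with $e^z\oplus e^w=e^{z+w}$, $e^z\ominus e^w=e^{z-w}$, $e^z\odot e^w=e^{zw}$; this is a field with zero $1=e^0$ and identity $e=e^1$. The geometric modulus is $|e^z|_G=e^{|z|}$. In the definitions below all arithmetic is geometric: for real $c$, $c\,e^z$ means $e^{cz}$; for $a\ge0$ and $\rho=e^r>1$, $e^a/\rho$ means $e^{a/r}$; $M(e^a)$ means $e^{M(a)}$; $G\sum_k e^{a_k}=e^{\sum_k a_k}$; $G\lim_n e^{a_n}=e^{\lim_n a_n}$; for a finite set $A$ of cardinality $N$, $|A|^G=e^{N}$. $\omega(G)$ is the set of all sequences $x=(x_k)_{k\ge0}$ in $\mathbb C(G)$. For $x\in\omega(G)$ and $k\ge1$ put $y_k=\frac{f_k}{f_{k+1}}x_k\ominus\frac{f_{k+1}}{f_k}x_{k-1}$.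 Define $[V,\lambda,M,\widehat F]^G=\{x\in\omega(G): G\lim_{n}\frac1{\lambda_n}G\sum_{k\in I_n}M(|y_k\ominus\ell|_G/\rho)=1\text{ for some }\ell\in\mathbb C(G),\ \rho>1\}$. A sequence $x$ is $S_\lambda^G(\widehat F)$-convergent to $\ell\in\mathbb C(G)$ if for every $\varepsilon>1$, $G\lim_{n}\frac1{\lambda_n}|\{k\in I_n:|y_k\ominus\ell|_G\ge\varepsilon\}|^G=1$; $S_\lambda^G(\widehat F)$ is the set of all $x\in\omega(G)$ that are $S_\lambda^G(\widehat F)$-convergent to some $\ell$. In exponents, with $x_k=e^{z_k}$, $w_k=\frac{f_k}{f_{k+1}}z_k-\frac{f_{k+1}}{f_k}z_{k-1}$, $\ell=e^L$, $\rho=e^r$: the first condition is $\frac1{\lambda_n}\sum_{k\in I_n}M(|w_k-L|/r)\to0$ for some $L\in\mathbb C$, $r>0$; the second is $\frac1{\lambda_n}\#\{k\in I_n:|w_k-L|\ge\eta\}\to0$ for every $\eta>0$. *)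

(* Defs.v *)
From mathcomp Require Export all_boot all_order all_algebra.
From mathcomp Require Export all_classical all_reals all_analysis.
From mathcomp Require Export complex.
Export Order.TTheory GRing.Theory Num.Theory numFieldNormedType.Exports.

Set Implicit Arguments.
Unset Strict Implicit.
Unset Printing Implicit Defensive.

Local Open Scope classical_set_scope.
Local Open Scope ring_scope.

Fixpoint fib (n : nat) : nat :=
  if n is (n'.+1 as p).+1 then (fib p + fib n')%N else 1%N.

(* [Gexp z] is the formal element e^z of C(G). The complex exponential is not
   injective, so a separate type is needed for e^z = e^w to mean z = w. *)
Record geoC (R : realType) : Type := Gexp { Glog : R[i] }.

(* Geometric reals e^a (a real) are represented by genuine positive reals, as
   the real exponential is a bijection onto them; [ln] recovers the exponent.
   In particular the comparisons with 1 below are the usual ones. *)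
Section GeometricArithmetic.
Variable R : realType.

Definition Gsub (x y : geoC R) : geoC R := Gexp (Glog x - Glog y).

Definition Gscale (c : R) (x : geoC R) : geoC R := Gexp (c%:C%C * Glog x).

(* [ComplexField.Normc.normc] is the R-valued modulus of R[i]. *)
Definition Gmod (x : geoC R) : R := expR (ComplexField.Normc.normc (Glog x)).

Definition Grscale (c u : R) : R := expR (c * ln u).

Definition Gdiv (u rho : R) : R := expR (ln u / ln rho).

Definition Gfun (M : R -> R) (u : R) : R := expR (M (ln u)).

Definition Gsum (T : finType) (A : {set T}) (u : T -> R) : R :=
  expR (\sum_(k in A) ln (u k)).

Definition Gcard (T : finType) (A : {set T}) : R := expR (#|A|%:R).

Definition Gcvg (u : nat -> R) (l : R) : Prop :=
  ln (u n) @[n --> \oo] --> ln l.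

End GeometricArithmetic.

Definition orlicz (R : realType) (M : R -> R) : Prop :=
  [/\ {in [set x | 0 <= x] &, {homo M : x y / x <= y}},
      {within [set x | 0 <= x], continuous M},
      @convex_function R R^o [set x | 0 <= x] M,
      M 0 = 0
    & forall x : R, 0 < x -> 0 < M x].

Section Spaces.
Variables (R : realType) (lambda : nat -> R).

Definition admissible : Prop :=
  [/\ lambda 1%N = 1,
      forall n, (1 <= n)%N -> 0 < lambda n,
      forall n, (1 <= n)%N -> lambda n <= lambda n.+1,
      forall n, (1 <= n)%N -> lambda n.+1 <= lambda n + 1
    & lambda n @[n --> \oo] --> +oo].

(* For admissible [lambda] and n >= 1 one has lambda n <= n, so that every
   integer k in I_n satisfies 1 <= k <= n; indices in 'I_n.+1 lose nothing. *)
Definition window (n : nat) : {set 'I_n.+1} :=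
  finset (fun k : 'I_n.+1 => n%:R - lambda n + 1 <= (k : nat)%:R).

(* Meaningful for k >= 1; the value at k = 0 is never used. *)
Definition Fhat (x : nat -> geoC R) (k : nat) : geoC R :=
  Gsub (Gscale ((fib k)%:R / (fib k.+1)%:R) (x k))
       (Gscale ((fib k.+1)%:R / (fib k)%:R) (x k.-1)).

Definition V_lambda_M_F (M : R -> R) : set (nat -> geoC R) :=
  [set x | exists (l : geoC R) (rho : R), 1 < rho /\
    Gcvg (fun n => Grscale (lambda n)^-1
      (Gsum (window n)
        (fun k => Gfun M (Gdiv (Gmod (Gsub (Fhat x k) l)) rho)))) 1].

Definition S_lambda_F_cvg (x : nat -> geoC R) (l : geoC R) : Prop :=
  forall eps : R, 1 < eps ->
    Gcvg (fun n => Grscale (lambda n)^-1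
      (Gcard R (finset (fun k : 'I_n.+1 =>
        (k \in window n) && (eps <= Gmod (Gsub (Fhat x k) l)))))) 1.

Definition S_lambda_F : set (nat -> geoC R) :=
  [set x | exists l : geoC R, S_lambda_F_cvg x l].

End Spaces.

(* Main.v *)
(* In exponents this is Markov's inequality: each index k of the window with
   |w_k - L| >= eta contributes at least M(eta / r) > 0 to the sum of the
   M(|w_k - L| / r), so the density of such indices is at most
   M(eta / r)^-1 times the strong Cesaro mean. The same limit l works. *)
Require Import Defs.
Set Implicit Arguments.
Unset Strict Implicit.
Unset Printing Implicit Defensive.
Local Open Scope classical_set_scope.
Local Open Scope ring_scope.

Lemma card_le_markov (R : numFieldType) (T : finType) (A : {set T})
    (P : pred T) (u : T -> R) (c : R) :
  0 < c -> {in A, forall k, 0 <= u k} -> {in A, forall k, P k -> c <= u k} ->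
  (#|finset (fun k => (k \in A) && P k)|)%:R <= c^-1 * \sum_(k in A) u k.
Proof.
move=> c0 u0 Pu; rewrite mulrC ler_pdivlMr// mulr_natl -sumr_const.
under eq_bigl do rewrite finset.inE.
(* As a sum over all of [A], with term [c] on [P] and 0 off it, the count can be compared
   termwise. *)
rewrite big_mkcondr /=.
by apply: ler_sum => k kA; case: ifPn => [/(Pu k kA)|_] //; exact: u0.
Qed.

(** Geometric limit 1 means that the exponents tend to 0, so squeezing applies. *)
Lemma Gcvg_le (R : realType) (c : R) (u v : nat -> R) :
  (\forall n \near \oo, 0 <= ln (u n) <= c * ln (v n)) ->
  Gcvg v 1 -> Gcvg u 1.
Proof.
rewrite /Gcvg ln1 => uv v0; apply: (squeeze_cvgr uv); first exact: cvg_cst.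
by rewrite -(mulr0 c); apply: cvgM => //; exact: cvg_cst.
Qed.

Theorem theorem4p1 (R : realType) (lambda : nat -> R) (hlambda : admissible lambda)
    (M : R -> R) (hM : orlicz M) :
  V_lambda_M_F lambda M `<=` S_lambda_F lambda.
Proof.
case: hlambda hM => _ lambda_gt0 _ _ _ [M_homo _ _ M0 M_gt0].
have M_le x y : 0 <= x -> x <= y -> M x <= M y.
  by move=> x0 xy; apply: M_homo => //; rewrite inE //=; exact: le_trans xy.
move=> x [l [rho [rho1 Vx]]]; exists l => eps eps1.
have r0 : 0 < ln rho by exact: ln_gt0.
have eta0 : 0 < ln eps by exact: ln_gt0.
have c0 : 0 < M (ln eps / ln rho) by rewrite M_gt0 ?divr_gt0.
apply: (Gcvg_le (c := (M (ln eps / ln rho))^-1)) Vx.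
near=> n.
have l0 : 0 < lambda n by apply: lambda_gt0; near: n; exact: nbhs_infty_ge.
rewrite /Grscale /Gcard /Gsum !expRK mulr_ge0 ?invr_ge0 ?(ltW l0)//=.
rewrite mulrCA ler_pM2l ?invr_gt0//.
apply: card_le_markov => // k _; rewrite /Gfun /Gdiv /Gmod !expRK.
  (* Nonnegativity of [M] comes from [M 0 = 0] and monotonicity. *)
  rewrite -M0; apply: M_le => //.
  by rewrite divr_ge0 ?(ltW r0)//; case: Glog => a b; exact: sqrtr_ge0.
move=> epsk; apply: M_le; first by rewrite ltW ?divr_gt0.
(* Taking logarithms in [epsk] gives eta <= |w_k - L| with eta = [ln eps]. *)
rewrite ler_pM2r ?invr_gt0// -[leRHS]expRK ler_ln// posrE ?expR_gt0//.
exact: lt_trans eps1.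
Unshelve. all: by end_near.
Qed.
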